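(* In the M/G/$\infty$ polling system with $N\geqslant 2$ queues visited in the fixed cyclic order $1,2,\ldots,N$ described in the context, let $X_i^j$ be the number of customers in queue $j$ at a polling instant of queue $i$, and let $G_i(\mathbf z)=\mathbb{E}\bigl[\prod_{j=1}^N z_j^{X_i^j}\bigr]$ for $\mathbf z=(z_1,\ldots,z_N)$ with $|z_j|\leqslant 1$ for all $j$. Then, for consecutive polling instants of queues $i$ and $i+1$ (with queue $N+1$ understood as queue $1$), $$G_{i+1}(\mathbf{z})=\widetilde D_i\Bigl(\sum_{j=1}^N \lambda_j (1-z_j)\Bigr)\,\mathbb{E}\Bigl[e^{-V_i \sum_{j\neq i} \lambda_j (1-z_j)}\, e^{-\Lambda_i(V_i)(1-z_i)}\,G_i\bigl(z_1,\ldots,z_{i-1},\,p_i(V_i)+[1-p_i(V_i)] z_i,\,z_{i+1},\ldots,z_N\bigr)\Bigr],$$ where the expectation is over $V_i$, $\widetilde D_i(s)=\mathbb{E}[e^{-sD_i}]$, $p_i(t)=\mathbb{P}[B_i\leqslant t]$ and $\Lambda_i(t)=\lambda_i\int_0^t\mathbb{P}[B_i>y]\,\mathrm{d}y$.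
   Context: The system has $N\geqslant2$ infinite-buffer queues attended in cyclic order by a single group of infinitely many servers moving together. The polling instant of queue $i$ is the moment when the servers enter queue $i$. Customers arrive at queue $i$ according to a Poisson process with rate $\lambda_i$; the arrival processes are independent. The servers stay at queue $i$ for a random visit time $V_i$, during which queue $i$ works as an M/G/$\infty$ queue: customers present at the polling instant start service at that moment and customers arriving during the visit start service on arrival. Service times at queue $i$ are i.i.d. copies of $B_i$; customers completing service leave the system; a customer whose service is not completed by the end of the visit stays and receives at the next visit a fresh independent service time distributed as $B_i$. After the visit to queue $i$ the servers need a switch-over time $D_i$ before entering queue $i+1$. All arrival processes, visit times, service times and switch-over times are mutually independent. Equivalently, the evolution between consecutive polling instants is given by the law of motion $$X_{i+1}^j=\begin{cases}X_i^j+A_{j,1}(V_i)+A_{j,2}(D_i), & j\neq i,\\ \mathrm{Binom}(X_i^i,1-p_i(V_i))+\mathrm{Poisson}(\Lambda_i(V_i))+A_{i,2}(D_i), & j=i,\end{cases}$$ where $(X_i^1,\ldots,X_i^N)$, $V_i$ and $D_i$ are independent and, given these, all the displayed variables are independent, with $A_{j,k}(t)$ Poisson distributed with mean $\lambda_j t$, $\mathrm{Binom}(m,q)$ binomial with parameters $m$ and $q$, and $\mathrm{Poisson}(a)$ Poisson distributed with mean $a$. *)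

(* Defs.v *)
From HB Require Import structures.
From mathcomp Require Import all_boot all_order all_algebra.
From mathcomp Require Import complex.
From mathcomp Require Import all_classical all_reals all_analysis.

Set Implicit Arguments.
Unset Strict Implicit.
Unset Printing Implicit Defensive.

Import Order.TTheory GRing.Theory Num.Theory.
Import numFieldNormedType.Exports.

Local Open Scope classical_set_scope.
Local Open Scope ring_scope.

Definition expC {R : realType} (z : R[i]) : R[i] :=
  (real_complex R (expR (complex.Re z))) *
  Complex (cos (complex.Im z)) (sin (complex.Im z)).

(* [Rintegral] is a junk value on non-integrable functions; all the functions
   integrated below are bounded almost everywhere. *)
Definition expectationC {d} {T : measurableType d} {R : realType}
    (P : probability T R) (f : T -> R[i]) : R[i] :=
  Complex (\int[P]_w complex.Re (f w)) (\int[P]_w complex.Im (f w)).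

(* Unlike the library's [poisson_pmf], which is constantly 1 at rate 0, this is
   the Dirac mass at 0 when [a = 0] (as [0 ^+ 0 = 1]); rate 0 does occur here,
   since visit and switch-over times may vanish. *)
Definition poisson_mass {R : realType} (a : R) (k : nat) : R :=
  a ^+ k / k`!%:R * expR (- a).

Record polling_system (R : realType) (N : nat) := PollingSystem {
  arrival_rate : 'I_N -> R ;
  service_law : 'I_N -> probability R R ;
  visit_law : 'I_N -> probability R R ;
  switch_law : 'I_N -> probability R R ;
  arrival_rate_gt0 : forall i, 0 < arrival_rate i ;
  service_law_ge0 : forall i, service_law i `]-oo, 0[%classic = 0%E ;
  visit_law_ge0 : forall i, visit_law i `]-oo, 0[%classic = 0%E ;
  switch_law_ge0 : forall i, switch_law i `]-oo, 0[%classic = 0%E }.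

Section system_functions.
Context {R : realType} {N : nat} (S : polling_system R N).

Definition service_cdf (i : 'I_N) (t : R) : R :=
  fine (service_law S i `]-oo, t]%classic).

Definition Lambda (i : 'I_N) (t : R) : R :=
  arrival_rate S i *
  \int[lebesgue_measure]_(y in `[0, t]) fine (service_law S i `]y, +oo[%classic).

Definition switch_LST (i : 'I_N) (s : R[i]) : R[i] :=
  expectationC (switch_law S i) (fun x => expC (- (s * real_complex R x))).

End system_functions.

(* The process observed at the successive polling instants n = 0, 1, 2, ...:
   [queue n] is the queue polled at instant n, [qlen n j] is the number of
   customers then present in queue j, and [visit n], [switch n] are the visit
   and switch-over times that follow. The initial state [qlen 0] is arbitrary.
   [arr_visit n j] and [arr_switch n j] are the arrivals at queue j during
   [visit n] and [switch n]. Among the customers of the visited queue that are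
   still there at the end of the visit, [left_old n] counts those who were
   present at the polling instant and [left_new n] those who arrived during the
   visit. [arr_visit n (queue n)] plays no role. *)
Record polling_process {d} {T : measurableType d} {R : realType}
    (P : probability T R) (N : nat) (S : polling_system R N) :=
  PollingProcess {
  queue : nat -> 'I_N ;
  qlen : nat -> 'I_N -> {RV P >-> nat} ;
  visit : nat -> {RV P >-> R} ;
  switch : nat -> {RV P >-> R} ;
  arr_visit : nat -> 'I_N -> {RV P >-> nat} ;
  arr_switch : nat -> 'I_N -> {RV P >-> nat} ;
  left_old : nat -> {RV P >-> nat} ;
  left_new : nat -> {RV P >-> nat} ;
  queueS : forall n, queue n.+1 = ordS (queue n) ;
  law_of_motion : forall n j w, qlen n.+1 j w =
    (if j == queue n then left_old n w + left_new n w + arr_switch n j w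
     else qlen n j w + arr_visit n j w + arr_switch n j w)%N ;
  visit_time_law : forall n E, measurable E ->
    distribution P (visit n) E = visit_law S (queue n) E ;
  switch_time_law : forall n E, measurable E ->
    distribution P (switch n) E = switch_law S (queue n) E ;
  qlen_visit_switch_independent : forall n (x : 'I_N -> nat) (E F : set R),
    measurable E -> measurable F ->
    P [set w | [/\ forall j, qlen n j w = x j,
                   E (visit n w) & F (switch n w)]] =
    (P [set w | forall j, qlen n j w = x j] * P [set w | E (visit n w)] *
     P [set w | F (switch n w)])%E ;
  (* Joint conditional law of the new variables given the triple
     (qlen n, visit n, switch n): they are conditionally independent, with the
     displayed mass functions. The events {qlen n = x, visit n in E,
     switch n in F} form, with the empty set, a pi-system generating the
     conditioning sigma-algebra. *)
  conditional_law : forall n (x : 'I_N -> nat) (E F : set R)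
      (a b : 'I_N -> nat) (k l : nat),
    measurable E -> measurable F ->
    let i := queue n in
    let C := [set w | [/\ forall j, qlen n j w = x j,
                          E (visit n w) & F (switch n w)]] in
    P (C `&` [set w | [/\ forall j, j != i -> arr_visit n j w = a j,
                          left_old n w = k, left_new n w = l
                        & forall j, arr_switch n j w = b j]]) =
    (\int[P]_(w in C)
      ((\prod_(j | j != i) poisson_mass (arrival_rate S j * visit n w) (a j)) *
       binomial_pmf (qlen n i w) (1 - service_cdf S i (visit n w)) k *
       poisson_mass (Lambda S i (visit n w)) l *
       (\prod_j poisson_mass (arrival_rate S j * switch n w) (b j)))%:E)%E }.

Definition pgf {d} {T : measurableType d} {R : realType} (P : probability T R)
    {N : nat} (Y : 'I_N -> {RV P >-> nat}) (z : 'I_N -> R[i]) : R[i] :=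
  expectationC P (fun w => \prod_j z j ^+ Y j w).

Arguments pgf {d T R} P {N} Y z.

(* Main.v *)
(* Condition on the state [x], the visit time [V] and the switch-over time [D]
   at the polling instant: the next state is then a sum of independent
   Poisson and binomial counts, so its conditional generating function is an
   explicit product, and the independence of [x], [V] and [D] lets one
   integrate the factors separately. All infinite sums over states are
   replaced by sums over finite boxes [0, m)^J, where interchanging sums and
   integrals is plain linearity; dominated convergence then gives the limit
   as [m] grows. The only analytic input is that [\sum_k z ^ k * a ^ k /
   k!] converges to [exp (z * a)] for complex [z], where the exponential is
   given by [expR], [cos] and [sin]: both sides satisfy the same linear
   differential equation in the real variable [a]. *)

Require Import Defs.
From HB Require Import structures.
From mathcomp Require Import all_boot all_order all_algebra.
From mathcomp Require Import complex ring lra.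
From mathcomp Require Import all_classical all_reals all_analysis.
From mathcomp Require Import measurable_realfun.

Set Implicit Arguments.
Unset Strict Implicit.
Unset Printing Implicit Defensive.

Import Order.TTheory GRing.Theory Num.Theory.
Import numFieldNormedType.Exports.

Local Open Scope ring_scope.
Local Open Scope complex_scope.
Local Open Scope classical_set_scope.

(** * Complex arithmetic and convergence, by real and imaginary parts *)

Section complex_sequences.
Context {R : realType}.
Implicit Types (z : R[i]) (u v : nat -> R[i]).

Lemma complex_ReD z1 z2 : complex.Re (z1 + z2) = complex.Re z1 + complex.Re z2.
Proof. by case: z1 z2 => ? ? []. Qed.

Lemma complex_ImD z1 z2 : complex.Im (z1 + z2) = complex.Im z1 + complex.Im z2.
Proof. by case: z1 z2 => ? ? []. Qed.

Lemma complex_ReM z1 z2 : complex.Re (z1 * z2) =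
  complex.Re z1 * complex.Re z2 - complex.Im z1 * complex.Im z2.
Proof. by case: z1 z2 => ? ? []. Qed.

Lemma complex_ImM z1 z2 : complex.Im (z1 * z2) =
  complex.Re z1 * complex.Im z2 + complex.Im z1 * complex.Re z2.
Proof. by case: z1 z2 => ? ? []. Qed.

Lemma complex_ext z1 z2 : complex.Re z1 = complex.Re z2 ->
  complex.Im z1 = complex.Im z2 -> z1 = z2.
Proof. by case: z1 z2 => ? ? [? ?] /= -> ->. Qed.

Lemma normC_real (x : R) : `|x%:C| = `|x|%:C.
Proof. by rewrite normc_def /= expr0n addr0 sqrtr_sqr. Qed.

Lemma normr_Re_le z (M : R) : `|z| <= M%:C -> `|complex.Re z| <= M.
Proof. by move=> zM; rewrite -lecR (le_trans (normc_ge_Re _)). Qed.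

Lemma normr_Im_le z (M : R) : `|z| <= M%:C -> `|complex.Im z| <= M.
Proof.
(* Multiplication by a number of modulus 1 reduces the bound to the one on real parts. *)
have -> : complex.Im z = complex.Re ('i * - z).
  by case: z => a b /=; rewrite mul0r mul1r opprK add0r.
move=> zM; apply: normr_Re_le.
by rewrite normrM normrN normc_def /= expr0n expr1n add0r sqrtr1 mul1r.
Qed.

(** Componentwise, to match [expectationC]: limit theorems for real integrals then apply to each
    part. *)
Definition cvgC u z :=
  (complex.Re (u n) @[n --> \oo] --> complex.Re z) /\
  (complex.Im (u n) @[n --> \oo] --> complex.Im z).

Lemma cvgC_unique u z1 z2 : cvgC u z1 -> cvgC u z2 -> z1 = z2.
Proof.
by move=> [r1 i1] [r2 i2]; apply: complex_ext;
  [exact: (cvg_unique _ r1 r2)|exact: (cvg_unique _ i1 i2)].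
Qed.

Lemma cvgC_cst z : cvgC (fun=> z) z.
Proof. by split; exact: cvg_cst. Qed.

Lemma cvgC_near u v z : (\forall n \near \oo, u n = v n) -> cvgC u z ->
  cvgC v z.
Proof.
by move=> uv [r i]; split; [move: r|move: i]; apply: cvg_trans;
  apply: near_eq_cvg; near=> n; (have -> : u n = v n by near: n).
Unshelve. all: by end_near. Qed.

Lemma cvgCM u v z1 z2 : cvgC u z1 -> cvgC v z2 ->
  cvgC (fun n => u n * v n) (z1 * z2).
Proof.
move=> [r1 i1] [r2 i2]; split.
  under eq_fun do rewrite complex_ReM; rewrite complex_ReM.
  by apply: cvgB; exact: cvgM.
under eq_fun do rewrite complex_ImM; rewrite complex_ImM.
by apply: cvgD; exact: cvgM.
Qed.

Lemma cvgC_prod (I : finType) (u : I -> nat -> R[i]) (z : I -> R[i]) :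
  (forall i, cvgC (u i) (z i)) ->
  cvgC (fun n => \prod_i u i n) (\prod_i z i).
Proof.
move=> h; elim: (index_enum I) => [|i s IH].
  by under eq_fun do rewrite big_nil; rewrite big_nil; exact: cvgC_cst.
by under eq_fun do rewrite big_cons; rewrite big_cons; exact: cvgCM.
Qed.

End complex_sequences.

(** * Measurability of complex-valued functions *)

Section complex_measurability.
Context {R : realType} d (T : measurableType d).
Implicit Types f g : T -> R[i].

Definition cmeasurable f :=
  measurable_fun [set: T] (@complex.Re R \o f) /\
  measurable_fun [set: T] (@complex.Im R \o f).

Lemma cmeasurable_cst (z : R[i]) : cmeasurable (fun=> z).
Proof. by split; exact: measurable_cst. Qed.

Lemma cmeasurable_real (f : T -> R) :
  measurable_fun [set: T] f -> cmeasurable (fun x => (f x)%:C).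
Proof. by move=> mf; split => //; exact: measurable_cst. Qed.

Lemma cmeasurableD f g : cmeasurable f -> cmeasurable g ->
  cmeasurable (fun x => f x + g x).
Proof.
move=> [rf jf] [rg jg]; split.
  rewrite (_ : _ \o _ = (@complex.Re R \o f) \+ (@complex.Re R \o g)).
    exact: measurable_funD.
  by apply/funext => x /=; rewrite complex_ReD.
rewrite (_ : _ \o _ = (@complex.Im R \o f) \+ (@complex.Im R \o g)).
  exact: measurable_funD.
by apply/funext => x /=; rewrite complex_ImD.
Qed.

Lemma cmeasurableM f g : cmeasurable f -> cmeasurable g ->
  cmeasurable (fun x => f x * g x).
Proof.
move=> [rf jf] [rg jg]; split.
  rewrite (_ : _ \o _ = ((@complex.Re R \o f) \* (@complex.Re R \o g)) \-
                        ((@complex.Im R \o f) \* (@complex.Im R \o g))).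
    by apply: measurable_funB; exact: measurable_funM.
  by apply/funext => x /=; rewrite complex_ReM.
rewrite (_ : _ \o _ = ((@complex.Re R \o f) \* (@complex.Im R \o g)) \+
                      ((@complex.Im R \o f) \* (@complex.Re R \o g))).
  by apply: measurable_funD; exact: measurable_funM.
by apply/funext => x /=; rewrite complex_ImM.
Qed.

Lemma cmeasurable_sum (I : Type) (s : seq I) (f : I -> T -> R[i]) :
  (forall i, cmeasurable (f i)) -> cmeasurable (fun x => \sum_(i <- s) f i x).
Proof.
move=> mf; elim: s => [|i s IH].
  by under eq_fun do rewrite big_nil; exact: cmeasurable_cst.
by under eq_fun do rewrite big_cons; exact: cmeasurableD.
Qed.

Lemma cmeasurable_prod (I : Type) (s : seq I) (f : I -> T -> R[i]) :
  (forall i, cmeasurable (f i)) -> cmeasurable (fun x => \prod_(i <- s) f i x).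
Proof.
move=> mf; elim: s => [|i s IH].
  by under eq_fun do rewrite big_nil; exact: cmeasurable_cst.
by under eq_fun do rewrite big_cons; exact: cmeasurableM.
Qed.

Lemma cmeasurableX f n : cmeasurable f -> cmeasurable (fun x => f x ^+ n).
Proof.
move=> mf; elim: n => [|n IH]; first exact: cmeasurable_cst.
by under eq_fun do rewrite exprS; exact: cmeasurableM.
Qed.

End complex_measurability.

(** * Integrability, linearity and dominated convergence for [expectationC] *)

Section complex_expectation.
Context {R : realType} d (T : measurableType d) (P : probability T R).
Implicit Types f g : T -> R[i].

(** A constant is integrable for a probability. The bound is asked only almost everywhere because
    Poisson masses are controlled only at nonnegative times. *)
Lemma ae_bounded_integrable (f : T -> R) (M : R) :
  measurable_fun [set: T] f -> {ae P, forall x, `|f x| <= M} ->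
  P.-integrable [set: T] (EFin \o f).
Proof.
move=> mf fM; apply/integrableP; split; first exact/measurable_EFinP.
apply: (@le_lt_trans _ _ (\int[P]_x (cst `|M|%:E x))%E).
  apply: ae_ge0_le_integral => //.
    by apply: measurableT_comp => //; exact/measurable_EFinP.
    by move=> x _; rewrite lee_fin.
  by move: fM; apply: filterS => x fxM _; rewrite lee_fin (le_trans fxM)// ler_norm.
rewrite integral_cst// [X in (_ * X)%E](_ : _ = 1%E) ?mule1 ?ltry//.
exact: probability_setT.
Qed.

(** Dominated convergence with a constant as the dominating function. *)
Lemma ae_bounded_cvg_Rintegral (f_ : nat -> T -> R) (f : T -> R) (M : R) :
  (forall n, measurable_fun [set: T] (f_ n)) ->
  (forall x, f_ n x @[n --> \oo] --> f x) ->
  {ae P, forall x, forall n, `|f_ n x| <= M} ->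
  \int[P]_x f_ n x @[n --> \oo] --> \int[P]_x f x.
Proof.
move=> mf_ ff fM; have mf : measurable_fun [set: T] f.
  exact: measurable_fun_cvg mf_ _.
have [|||||intf _ cf] := @dominated_convergence _ _ _ P setT measurableT
    (fun n => EFin \o f_ n) (EFin \o f) (cst M%:E).
- by move=> n; exact/measurable_EFinP.
- exact/measurable_EFinP.
- by apply: aeW => x _; apply: cvg_EFin; [exact: nearW|exact: ff].
- by apply: finite_measure_integrable_cst.
- by move: fM; apply: filterS => x fxM n _; rewrite lee_fin.
apply: fine_cvg; rewrite fineK; first exact: cf.
exact: integrable_fin_num.
Qed.

Definition cintegrable f :=
  P.-integrable [set: T] (EFin \o (@complex.Re R \o f)) /\
  P.-integrable [set: T] (EFin \o (@complex.Im R \o f)).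

Lemma ae_bounded_cvg_expectationC (f_ : nat -> T -> R[i]) f (M : R) :
  (forall n, cmeasurable (f_ n)) -> (forall x, cvgC (f_ ^~ x) (f x)) ->
  {ae P, forall x, forall n, `|f_ n x| <= M%:C} ->
  cvgC (fun n => expectationC P (f_ n)) (expectationC P f).
Proof.
move=> mf ff fM; split.
  apply: (ae_bounded_cvg_Rintegral (M := M)
           (f_ := fun n => @complex.Re R \o f_ n) (f := @complex.Re R \o f)).
  - by move=> n; exact: (mf n).1.
  - by move=> x; exact: (ff x).1.
  - by move: fM; apply: filterS => x fx n; exact: normr_Re_le.
apply: (ae_bounded_cvg_Rintegral (M := M)
         (f_ := fun n => @complex.Im R \o f_ n) (f := @complex.Im R \o f)).
- by move=> n; exact: (mf n).2.
- by move=> x; exact: (ff x).2.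
- by move: fM; apply: filterS => x fx n; exact: normr_Im_le.
Qed.

Lemma cintegrableD f g : cintegrable f -> cintegrable g ->
  cintegrable (fun x => f x + g x).
Proof.
move=> [rf jf] [rg jg]; split.
  rewrite (_ : _ \o _ = (EFin \o (@complex.Re R \o f)) \+
                        (EFin \o (@complex.Re R \o g)))%E.
    exact: integrableD.
  by apply/funext => x /=; rewrite complex_ReD.
rewrite (_ : _ \o _ = (EFin \o (@complex.Im R \o f)) \+
                      (EFin \o (@complex.Im R \o g)))%E.
  exact: integrableD.
by apply/funext => x /=; rewrite complex_ImD.
Qed.

Lemma expectationCD f g : cintegrable f -> cintegrable g ->
  expectationC P (fun x => f x + g x) = expectationC P f + expectationC P g.
Proof.
move=> [rf jf] [rg jg]; apply: complex_ext; rewrite ?complex_ReD ?complex_ImD /=.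
  by rewrite -RintegralD//; apply: eq_Rintegral => x _; rewrite complex_ReD.
by rewrite -RintegralD//; apply: eq_Rintegral => x _; rewrite complex_ImD.
Qed.

Lemma expectationC0 : expectationC P (fun=> 0) = 0.
Proof. by apply: complex_ext; rewrite /= Rintegral_cst// mul0r. Qed.

Lemma cintegrable0 : cintegrable (fun=> 0).
Proof. by split; exact: finite_measure_integrable_cst. Qed.

Lemma cintegrable_sum (I : Type) (s : seq I) (f : I -> T -> R[i]) :
  (forall i, cintegrable (f i)) -> cintegrable (fun x => \sum_(i <- s) f i x).
Proof.
move=> mf; elim: s => [|i s IH].
  by under eq_fun do rewrite big_nil; exact: cintegrable0.
by under eq_fun do rewrite big_cons; exact: cintegrableD.
Qed.

Lemma expectationC_sum (I : Type) (s : seq I) (f : I -> T -> R[i]) :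
  (forall i, cintegrable (f i)) ->
  expectationC P (fun x => \sum_(i <- s) f i x) =
  \sum_(i <- s) expectationC P (f i).
Proof.
move=> mf; elim: s => [|i s IH].
  by under eq_fun do rewrite big_nil; rewrite big_nil expectationC0.
under eq_fun do rewrite big_cons.
by rewrite big_cons expectationCD ?IH//; exact: cintegrable_sum.
Qed.

(** This is the shape of each term of the truncated sums below: a complex monomial times a real
    mass. *)
Lemma cintegrableZ_real (c : R[i]) (f : T -> R) :
  P.-integrable [set: T] (EFin \o f) -> cintegrable (fun x => c * (f x)%:C).
Proof.
move=> mf; split.
  rewrite (_ : _ \o _ = (fun x => (complex.Re c)%:E * (EFin \o f) x)%E).
    exact: integrableZl.
  by apply/funext => x /=; rewrite complex_ReM /= mulr0 subr0.
rewrite (_ : _ \o _ = (fun x => (complex.Im c)%:E * (EFin \o f) x)%E).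
  exact: integrableZl.
by apply/funext => x /=; rewrite complex_ImM /= mulr0 add0r.
Qed.

Lemma expectationCZ_real (c : R[i]) (f : T -> R) :
  P.-integrable [set: T] (EFin \o f) ->
  expectationC P (fun x => c * (f x)%:C) = c * (\int[P]_x f x)%:C.
Proof.
move=> mf; apply: complex_ext; rewrite ?complex_ReM ?complex_ImM /= ?mulr0 ?subr0 ?add0r.
  by rewrite -RintegralZl//; apply: eq_Rintegral => x _;
    rewrite complex_ReM /= mulr0 subr0.
by rewrite -RintegralZl//; apply: eq_Rintegral => x _;
  rewrite complex_ImM /= mulr0 add0r.
Qed.

End complex_expectation.

(** * The power series of the complex exponential *)

Section complex_exponential.
Context {R : realType}.
Implicit Types (z w : R[i]) (x : R).

Lemma expC0 : expC (0 : R[i]) = 1.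
Proof. by rewrite /expC /= expR0 cos0 sin0 mul1r. Qed.

Lemma expCD z w : expC (z + w) = expC z * expC w.
Proof.
rewrite /expC complex_ReD complex_ImD expRD cosD sinD.
by apply: complex_ext => /=; ring.
Qed.

Lemma expC_sum (I : Type) (s : seq I) (p : pred I) (f : I -> R[i]) :
  expC (\sum_(i <- s | p i) f i) = \prod_(i <- s | p i) expC (f i).
Proof. exact: (big_morph _ expCD expC0). Qed.

(* The real parts of the coefficients of [x |-> w * exp (z * x)]; multiplying
   [w] by [z] differentiates the series. *)
Let coef z w : nat -> R := fun k => complex.Re (w * z ^+ k) / k`!%:R.

Let coef_series z w x : R := limn (pseries (coef z w) x).

(** The series is dominated termwise by [|w|] times the exponential series at [|z| * |x|]. *)
Let cvg_coef z w x : cvgn (pseries (coef z w) x).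
Proof.
pose r := complex.Re `|z|; pose C := complex.Re `|w|.
have rE : `|z| = r%:C by rewrite RRe_real ?normr_real.
have CE : `|w| = C%:C by rewrite RRe_real ?normr_real.
have r0 : 0 <= r by rewrite -ler0c -rE.
have C0 : 0 <= C by rewrite -ler0c -CE.
apply: normed_cvg.
apply: (@series_le_cvg _ _ (fun k => C * exp_coeff (r * `|x|) k)) => [k|k|k|].
- by rewrite normr_ge0.
- by rewrite mulr_ge0// exp_coeff_ge0// mulr_ge0.
- have h : `|complex.Re (w * z ^+ k)| <= C * r ^+ k.
    by apply: normr_Re_le; rewrite normrM normrX rE CE -rmorphXn -rmorphM.
  rewrite /coef /exp_coeff /= !normrM normfV normr_nat normrX exprMn.
  rewrite (_ : C * _ = C * r ^+ k * k`!%:R^-1 * `|x| ^+ k); last by ring.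
  by rewrite ler_wpM2r ?exprn_ge0// ler_wpM2r ?invr_ge0.
- by apply: is_cvg_seriesZ; exact: is_cvg_series_exp_coeff.
Qed.

Let diffs_coef z w : pseries_diffs (coef z w) = coef z (w * z).
Proof.
apply/funext => k; rewrite /pseries_diffs /coef factS natrM invfM.
by rewrite mulrCA mulVKf ?pnatr_eq0// exprS mulrA.
Qed.

Let is_derive_coef_series z w x :
  is_derive x (1 : R) (coef_series z w) (coef_series z (w * z) x).
Proof.
rewrite /coef_series -diffs_coef.
(* Any point of larger modulus than [x] serves, as the series and its formal derivatives converge
   everywhere. *)
apply: (@pseries_snd_diffs _ _ (`|x| + 1)); rewrite ?diffs_coef//.
by rewrite [ltRHS]ger0_norm// ltrDl.
Qed.

(** The series is real-linear in [w], so the cases [1] and ['i] determine all others. This closes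
    the differential system below on two unknowns. *)
Let coef_seriesD z w x : coef_series z w x =
  complex.Re w * coef_series z 1 x + complex.Im w * coef_series z 'i x.
Proof.
apply: (cvg_lim (@Rhausdorff R)).
rewrite (_ : pseries _ _ = complex.Re w \*: pseries (coef z 1) x +
    complex.Im w \*: pseries (coef z 'i) x).
  by apply: cvgD; apply: cvgZr; exact: cvg_coef.
apply/funext => n; rewrite /pseries /series /= fctE /= !scaler_sumr -big_split.
apply: eq_bigr => k _ /=; rewrite /coef !complex_ReM /=.
rewrite /GRing.scale /=; ring.
Qed.

Let coef_series0 z w : coef_series z w 0 = complex.Re w.
Proof.
apply: (cvg_lim (@Rhausdorff R)).
(* The partial sum of length 0 is empty; after a shift by one, every partial sum equals the term of
   index 0. *)
rewrite -(cvg_shiftS _); apply: cvg_near_cst; apply: nearW => n.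
rewrite /pseries /series /= big_nat_recl// big1_seq ?addr0.
  by rewrite /coef expr0 !mulr1 divr1.
by move=> k _; rewrite expr0n /= mulr0.
Qed.

(** The two series solve a linear system with constant coefficients, and so do the two right-hand
    sides, with the same value at 0. The sign in the second one comes from
    [Re ('i * s) = - Im s]. *)
Let coef_seriesE z x :
  coef_series z 1 x = expR (complex.Re z * x) * cos (complex.Im z * x) /\
  coef_series z 'i x = - expR (complex.Re z * x) * sin (complex.Im z * x).
Proof.
set a := complex.Re z; set b := complex.Im z.
pose f := coef_series z 1; pose g := coef_series z 'i.
have df y : is_derive y (1 : R) f (a * f y + b * g y).
  by have := is_derive_coef_series z 1 y; rewrite mul1r (coef_seriesD z z).
have dg y : is_derive y (1 : R) g (- b * f y + a * g y).
  have := is_derive_coef_series z 'i y; rewrite (coef_seriesD z ('i * z)).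
  by rewrite complex_ReM complex_ImM /= !mul0r !mul1r sub0r add0r.
pose e y := expR (- a * y); pose c y := cos (b * y); pose s y := sin (b * y).
have de y : is_derive y (1 : R) e (- a * e y).
  by rewrite /e; apply: is_derive_eq; rewrite /GRing.scale /= !mulr1 mulrC.
have dc y : is_derive y (1 : R) c (- b * s y).
  by rewrite /c; apply: is_derive_eq; rewrite /GRing.scale /= !mulr1 -/(s y); ring.
have ds y : is_derive y (1 : R) s (b * c y).
  by rewrite /s; apply: is_derive_eq; rewrite /GRing.scale /= !mulr1 -/(c y); ring.
(* [u] and [- v] are the real and imaginary parts of [exp (- z * y) * (f y - 'i * g y)], which has
   derivative 0. *)
pose u y := e y * (c y * f y - s y * g y).
pose v y := e y * (s y * f y + c y * g y).
have du y : is_derive y (1 : R) u 0.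
  by apply: is_derive_eq; rewrite /GRing.scale /=; ring.
have dv y : is_derive y (1 : R) v 0.
  by apply: is_derive_eq; rewrite /GRing.scale /=; ring.
have u1 : u x = 1.
  rewrite (is_derive_0_is_cst x 0 du) /u /f /g !coef_series0 /e /c /s.
  by rewrite /= !mulr0 expR0 cos0 subr0 !mulr1.
have v0 : v x = 0.
  rewrite (is_derive_0_is_cst x 0 dv) /v /f /g !coef_series0 /e /c /s.
  by rewrite /= !mulr0 sin0 mul0r addr0 mulr0.
have cs : c x ^+ 2 + s x ^+ 2 = 1 := cos2Dsin2 _.
have eE : expR (a * x) * e x = 1 by rewrite -expRD mulNr subrr expR0.
(* Undoing the rotation and the damping expresses [f] and [g] through the constants [u] and [v]. *)
split.
  transitivity (expR (a * x) * (c x * u x + s x * v x)); last first.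
    by rewrite u1 v0 mulr0 addr0 mulr1.
  transitivity (expR (a * x) * e x * ((c x ^+ 2 + s x ^+ 2) * f x)).
    by rewrite eE cs !mul1r.
  by rewrite /u /v; ring.
transitivity (expR (a * x) * (- s x * u x + c x * v x)); last first.
  by rewrite u1 v0 mulr0 addr0 mulr1 mulNr mulrN.
transitivity (expR (a * x) * e x * ((c x ^+ 2 + s x ^+ 2) * g x)).
  by rewrite eE cs !mul1r.
by rewrite /u /v; ring.
Qed.

Lemma cvgC_expC_series z x :
  cvgC (fun n => \sum_(k < n) z ^+ k * (x ^+ k / k`!%:R)%:C) (expC (z * x%:C)).
Proof.
have [f_eq g_eq] := coef_seriesE z x.
have zxR : complex.Re (z * x%:C) = complex.Re z * x.
  by rewrite complex_ReM /= mulr0 subr0.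
have zxI : complex.Im (z * x%:C) = complex.Im z * x.
  by rewrite complex_ImM /= mulr0 add0r.
split.
  rewrite /expC zxR zxI /= mul0r subr0 -f_eq.
  rewrite (_ : (fun _ => _) = pseries (coef z 1) x); first exact: cvg_coef.
  apply/funext => n; rewrite /pseries /series /= big_mkord.
  rewrite (big_morph _ complex_ReD (erefl _)).
  apply: eq_bigr => k _; rewrite complex_ReM /coef /= mulr0 subr0 mul1r.
  by rewrite mulrAC mulrA.
rewrite /expC zxR zxI /= mul0r addr0 -[_ * _]opprK -mulNr -g_eq.
rewrite (_ : (fun _ => _) = - pseries (coef z 'i) x).
  by apply: cvgN; exact: cvg_coef.
apply/funext => n; rewrite fctE /pseries /series /= big_mkord -sumrN.
rewrite (big_morph _ complex_ImD (erefl _)).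
apply: eq_bigr => k _; rewrite complex_ImM /coef complex_ReM /= mulr0 add0r.
by rewrite mul0r mul1r sub0r; ring.
Qed.

End complex_exponential.

(** * Generating functions of Poisson and binomial masses *)

Section poisson_binomial_transforms.
Context {R : realType}.
Implicit Types (z : R[i]) (a q : R).

Lemma poisson_mass_ge0 a k : 0 <= a -> 0 <= poisson_mass a k.
Proof. by move=> a0; rewrite !mulr_ge0// ?expR_ge0// exprn_ge0. Qed.

(** For [0 <= a] the partial sums of the exponential series increase to [expR a]. *)
Lemma poisson_mass_sum_le1 a m : 0 <= a -> \sum_(k < m) poisson_mass a k <= 1.
Proof.
move=> a0; rewrite -(mulfV (lt0r_neq0 (expR_gt0 a))) -expRN -mulr_suml.
rewrite ler_wpM2r ?expR_ge0//.
have := is_cvg_series_exp_coeff a; move=> /nondecreasing_cvgn_le.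
rewrite /series /= => h; rewrite -(big_mkord xpredT (fun k => a ^+ k / k`!%:R)).
apply: h => u v uv; rewrite !big_mkord.
rewrite -(subnKC uv) big_split_ord /= lerDl sumr_ge0// => k _.
by rewrite divr_ge0// exprn_ge0.
Qed.

Lemma poisson_mass_le1 a k : 0 <= a -> poisson_mass a k <= 1.
Proof.
move=> a0; apply: le_trans (poisson_mass_sum_le1 k.+1 a0).
by rewrite big_ord_recr /= lerDr sumr_ge0// => j _; exact: poisson_mass_ge0.
Qed.

Lemma measurable_poisson_mass k :
  measurable_fun [set: R] (fun a : R => poisson_mass a k).
Proof.
apply: measurable_funM; first exact: measurable_funM.
by apply: measurableT_comp; [exact: measurable_expR|exact: measurable_funN].
Qed.

(** The bound is uniform in [m], which is what dominated convergence needs. *)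
Lemma norm_poisson_transform_le1 z a m : `|z| <= 1 -> 0 <= a ->
  `|\sum_(k < m) z ^+ k * (poisson_mass a k)%:C| <= 1.
Proof.
move=> z1 a0; apply: (le_trans (ler_norm_sum _ _ _)).
apply: (@le_trans _ _ (\sum_(k < m) (poisson_mass a k)%:C)); last first.
  by rewrite -rmorph_sum lecR poisson_mass_sum_le1.
apply: ler_sum => k _; rewrite normrM normC_real normrX.
rewrite (ger0_norm (poisson_mass_ge0 _ a0)).
by rewrite ler_piMl ?ler0c ?poisson_mass_ge0// exprn_ile1.
Qed.

(** The factor [expR (- a)] leaves the sum, and the exponential series at [z * a] remains. The sign
    of [a] is free, since pointwise convergence will be required at negative times too. *)
Lemma cvgC_poisson_transform z a :
  cvgC (fun m => \sum_(k < m) z ^+ k * (poisson_mass a k)%:C)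
       (expC (- (a%:C * (1 - z)))).
Proof.
have -> : - (a%:C * (1 - z)) = z * a%:C + (- a)%:C by rewrite rmorphN; ring.
rewrite expCD.
have -> : expC (- a)%:C = (expR (- a))%:C :> R[i].
  by rewrite /expC /= cos0 sin0 mulr1.
have := cvgCM (cvgC_expC_series z a) (cvgC_cst (expR (- a))%:C).
apply: cvgC_near; apply: nearW => m; rewrite mulr_suml.
by apply: eq_bigr => k _; rewrite /poisson_mass -mulrA -rmorphM.
Qed.

Lemma binomial_pmf_le n q k : 0 <= q <= 1 ->
  0 <= binomial_pmf n q k <= 'C(n, k)%:R.
Proof.
move=> q01; rewrite binomial_pmf_ge0//= /binomial_pmf -mulr_natr.
have /andP[q0 q1] := q01.
have /andP[r0 r1] : 0 <= 1 - q <= 1 by lra.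
by rewrite ler_piMl// mulr_ile1 ?exprn_ge0 ?exprn_ile1.
Qed.

(** The range [k < m] covers the whole support [k <= n], so truncation is exact and the binomial
    theorem applies. *)
Lemma binomial_transform z q n m : (n < m)%N ->
  \sum_(k < m) z ^+ k * (binomial_pmf n q k)%:C =
  ((1 - q)%:C + q%:C * z) ^+ n.
Proof.
move=> nm; rewrite exprDn -(subnKC nm) big_split_ord /=.
rewrite [X in _ + X]big1 ?addr0 => [|k _]; last first.
  by rewrite /binomial_pmf bin_small ?mulr0n ?mulr0// addSn ltnS leq_addr.
apply: eq_bigr => k _; rewrite /binomial_pmf rmorphMn rmorphM !rmorphXn.
rewrite mulrnAr exprMn; congr (_ *+ _).
by rewrite mulrC [RHS]mulrA; congr (_ * _); rewrite mulrC.
Qed.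

End poisson_binomial_transforms.

(** * Bounds and measurability of [service_cdf] and [Lambda] *)

Section system_functions_theory.
Context {R : realType} {N : nat} (S : polling_system R N).
Implicit Types i : 'I_N.

Let fine_probability_itv01 (P : probability R R) (A : set R) : measurable A ->
  0 <= fine (P A) <= 1.
Proof.
move=> mA; rewrite fine_ge0//= -lee_fin fineK ?probability_le1//.
exact: fin_num_measure.
Qed.

Let fine_probability_le (P : probability R R) (A B : set R) :
  measurable A -> measurable B -> A `<=` B -> fine (P A) <= fine (P B).
Proof.
move=> mA mB AB; apply: fine_le; rewrite ?fin_num_measure//.
by apply: le_measure; rewrite ?inE.
Qed.

Lemma service_cdf_itv01 i t : 0 <= service_cdf S i t <= 1.
Proof. exact: fine_probability_itv01. Qed.

Lemma service_cdf_nondecreasing i : nondecreasing_fun (service_cdf S i).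
Proof.
move=> s t st; apply: fine_probability_le => //.
by apply: subset_itvl; rewrite bnd_simp.
Qed.

Lemma measurable_service_cdf i : measurable_fun [set: R] (service_cdf S i).
Proof.
by apply: nondecreasing_measurable => //; exact: service_cdf_nondecreasing.
Qed.

Lemma Lambda_ge0 i t : 0 <= Lambda S i t.
Proof.
rewrite mulr_ge0 ?(ltW (arrival_rate_gt0 _ _))//.
by apply: Rintegral_ge0 => y _; rewrite fine_ge0.
Qed.

(** A nonnegative integrand is integrated over growing intervals. The integrals are finite because
    the survival function is at most 1 and the intervals have finite length. Monotonicity is the
    route to measurability. *)
Lemma Lambda_nondecreasing i : nondecreasing_fun (Lambda S i).
Proof.
pose surv y := fine (service_law S i `]y, +oo[).
have msurv D : measurable D -> measurable_fun D surv.
  move=> mD; apply: nonincreasing_measurable => // x y xy.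
  apply: fine_probability_le => //.
  by apply: subset_itvr; rewrite bnd_simp.
have intf t : (\int[lebesgue_measure]_(y in `[0%R, t]) (surv y)%:E)%E
    \is a fin_num.
  apply: integrable_fin_num => //.
  apply: measurable_bounded_integrable => //.
  - by rewrite /= lebesgue_measure_itv /=; case: ifPn; rewrite // ltry.
  - exact: msurv.
  - exists 1; split => // M M1 y _ /=.
    have /andP[h0 h1] : 0 <= surv y <= 1 by exact: fine_probability_itv01.
    by rewrite ger0_norm// (le_trans h1)// ltW.
move=> s t st; rewrite /Lambda ler_wpM2l ?(ltW (arrival_rate_gt0 _ _))//.
apply: fine_le; rewrite ?intf//.
apply: ge0_subset_integral => //.
- by apply/measurable_EFinP; exact: msurv.
- by move=> y _; rewrite lee_fin fine_ge0.
- by apply: subset_itvl; rewrite bnd_simp.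
Qed.

Lemma measurable_Lambda i : measurable_fun [set: R] (Lambda S i).
Proof.
by apply: nondecreasing_measurable => //; exact: Lambda_nondecreasing.
Qed.

End system_functions_theory.

(** * Factorisation of integrals under independence *)

Section independence.
Context {R : realType} d (T : measurableType d) (P : probability T R).
Local Open Scope ereal_scope.

(** The complement of [A] is a null set of the restricted measure, and inside [A] the two measures
    agree. *)
Lemma ge0_integral_mrestr (A : set T) (mA : measurable A) (h : T -> \bar R) :
  measurable_fun [set: T] h -> (forall w, 0 <= h w) ->
  \int[mrestr P mA]_w h w = \int[P]_(w in A) h w.
Proof.
move=> mh h0; rewrite -(setvU A) ge0_integral_setU//; last 3 first.
- exact: measurableC.
- by rewrite setvU.
- by apply/disj_setPS; rewrite setICl.
rewrite null_set_integral ?add0e.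
- apply: eq_measure_integral => E mE EA.
  by rewrite -[RHS](congr1 P (setIidl EA)).
- exact: measurableC.
- exact: measurable_funTS.
- by rewrite -[RHS](measure0 P) -(setICl A).
Qed.

(** The image under [(V, W)] of [P] restricted to [A] agrees on rectangles with [P A] times the
    product of [m1] and [m2]. Uniqueness of the product measure and Tonelli's theorem do the
    rest. *)
Lemma ge0_integral_independent (A : set T) (V W : T -> R)
    (m1 m2 : probability R R) (f g : R -> \bar R) :
  measurable A -> measurable_fun [set: T] V -> measurable_fun [set: T] W ->
  (forall E F, measurable E -> measurable F ->
    P (A `&` (V @^-1` E `&` W @^-1` F)) = P A * m1 E * m2 F) ->
  measurable_fun [set: R] f -> measurable_fun [set: R] g ->
  (forall x, 0 <= f x) -> (forall x, 0 <= g x) ->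
  \int[P]_(w in A) (f (V w) * g (W w)) =
  P A * (\int[m1]_v f v * \int[m2]_u g u).
Proof.
move=> mA mV mW ind mf mg f0 g0.
have mVW : measurable_fun [set: T] (fun w => (V w, W w)).
  exact: measurable_fun_pair.
pose VW_mixin := isMeasurableFun.Build _ _ _ _ _ mVW.
pose VW : {mfun T >-> (R * R)%type} := HB.pack (fun w => (V w, W w)) VW_mixin.
(* The mass of [A] as a nonnegative real, the type of scalar that [mscale] takes; it is absorbed in
   the first factor. *)
pose c : {nonneg R} := NngNum (fine_ge0 (measure_ge0 P A)).
have cE : c%:num%:E = P A by rewrite /= fineK// fin_num_measure.
pose h (z : R * R) := f z.1 * g z.2.
have mh : measurable_fun [set: R * R] h.
  by apply: emeasurable_funM; exact: measurableT_comp.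
have h0 z : 0 <= h z by rewrite mule_ge0.
rewrite -(ge0_integral_mrestr mA (h := h \o VW)); last 2 first.
- exact: measurableT_comp.
- by move=> w; exact: h0.
have -> : \int[mrestr P mA]_w (h \o VW) w = \int[pushforward (mrestr P mA) VW]_z h z.
  by rewrite ge0_integral_pushforward.
rewrite (eq_measure_integral (mscale c m1 \x m2)); last first.
  move=> /= E mE _; apply/esym; apply: product_measure_unique => // E1 F1 mE1 mF1.
  rewrite -[LHS]/(P ((VW @^-1` (E1 `*` F1)) `&` A)).
  rewrite -[RHS]/(c%:num%:E * m1 E1 * m2 F1) cE -ind//.
  by rewrite setIC.
have mG : measurable_fun [set: R] (fun v => f v * \int[m2]_u g u).
  by apply: emeasurable_funM => //; exact: measurable_cst.
have G0 : 0 <= \int[m2]_u g u by apply: integral_ge0 => u _; exact: g0.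
rewrite fubini_tonelli1//.
transitivity (\int[mscale c m1]_v (f v * \int[m2]_u g u)).
  by apply: eq_integral => v _; rewrite /fubini_F /h /= ge0_integralZl.
rewrite ge0_integral_mscale// => [|v _]; last by rewrite mule_ge0.
by rewrite ge0_integralZr// cE.
Qed.

(** The kernels are nonnegative only at nonnegative times. Passing to absolute values changes them
    on null sets only and makes the nonnegative version applicable. *)
Lemma Rintegral_independent_nneg (A : set T) (V W : T -> R)
    (m1 m2 : probability R R) (f g : R -> R) :
  measurable A -> measurable_fun [set: T] V -> measurable_fun [set: T] W ->
  (forall E F, measurable E -> measurable F ->
    P (A `&` (V @^-1` E `&` W @^-1` F)) = P A * m1 E * m2 F) ->
  {ae P, forall w, (0 <= V w)%R} -> {ae P, forall w, (0 <= W w)%R} ->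
  {ae m1, forall v : R, (0 <= v)%R} -> {ae m2, forall v : R, (0 <= v)%R} ->
  m1.-integrable [set: R] (EFin \o f) -> m2.-integrable [set: R] (EFin \o g) ->
  (forall v, (0 <= v)%R -> (0 <= f v)%R) ->
  (forall v, (0 <= v)%R -> (0 <= g v)%R) ->
  (\int[P]_(w in A) (f (V w) * g (W w)) =
   fine (P A) * (\int[m1]_v f v * \int[m2]_v g v))%R.
Proof.
move=> mA mV mW ind V0 W0 m10 m20 intf intg f0 g0.
have /measurable_EFinP mf := measurable_int _ intf.
have /measurable_EFinP mg := measurable_int _ intg.
have mfn : measurable_fun [set: R] (fun v => `|f v|%:E).
  by apply/measurable_EFinP; exact: measurableT_comp.
have mgn : measurable_fun [set: R] (fun v => `|g v|%:E).
  by apply/measurable_EFinP; exact: measurableT_comp.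
have fE : \int[m1]_v `|f v|%:E = \int[m1]_v (f v)%:E.
  apply: ae_eq_integral => //; first exact/measurable_EFinP.
  by move: m10; apply: filterS => v v0 _; rewrite ger0_norm// f0.
have gE : \int[m2]_v `|g v|%:E = \int[m2]_v (g v)%:E.
  apply: ae_eq_integral => //; first exact/measurable_EFinP.
  by move: m20; apply: filterS => v v0 _; rewrite ger0_norm// g0.
rewrite /Rintegral -fineM ?integrable_fin_num//.
rewrite -fineM ?fin_numM ?integrable_fin_num ?fin_num_measure//.
congr fine; rewrite -fE -gE -(ge0_integral_independent mA mV mW ind)//.
apply: ae_eq_integral => //.
- apply/measurable_EFinP/measurable_funTS.
  by apply: measurable_funM; exact: measurableT_comp.
- apply: measurable_funTS.
  apply: emeasurable_funM; first exact: (measurableT_comp mfn mV).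
  exact: (measurableT_comp mgn mW).
- move: V0 W0; apply: filterS2 => w V0 W0 _.
  by rewrite EFinM !ger0_norm ?f0 ?g0.
Qed.

End independence.

(** * Expectations of discrete variables as limits of sums over finite boxes *)

Section discrete_expectation.
Context {R : realType} d (T : measurableType d) (P : probability T R).
Variables (Omega : Type) (U : T -> Omega) (K : nat -> finType).
Variable e : forall {m}, K m -> Omega.
Hypothesis e_inj : forall m, injective (@e m).
Hypothesis e_exhaust : forall x, \forall m \near \oo, exists u, @e m u = x.
Hypothesis mU : forall x, measurable [set w | U w = x].

Let law x : R := fine (P [set w | U w = x]).

Let int_ind x : \int[P]_w \1_[set w | U w = x] w = law x.
Proof. by rewrite /Rintegral integral_indic// setIT. Qed.

Let int_indC (c : R[i]) x :
  cintegrable P (fun w => c * (\1_[set w | U w = x] w)%:C) /\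
  expectationC P (fun w => c * (\1_[set w | U w = x] w)%:C) = c * (law x)%:C.
Proof.
have h : P.-integrable [set: T] (EFin \o \1_[set w | U w = x]).
  by apply: (ae_bounded_integrable (M := 1)) => //; apply: aeW => w;
    rewrite indicE; case: (_ \in _); rewrite ?normr0 ?normr1.
by split; [exact: cintegrableZ_real|rewrite expectationCZ_real// int_ind].
Qed.

(** By injectivity of [e], at most one point of the box is [U w], so at most one term survives. *)
Let truncE m (f : Omega -> R[i]) w :
  \sum_(u : K m) f (e u) * (\1_[set w' | U w' = e u] w)%:C =
  if pselect (exists u : K m, e u = U w) then f (U w) else 0.
Proof.
case: pselect => [[u uE]|nu].
  rewrite (bigD1 u)//= big1 ?addr0 => [|u' u'u].
    by rewrite indicE mem_set//= ?mulr1 uE.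
  rewrite indicE memNset ?mulr0//= => h.
  by move: u'u; rewrite (@e_inj m u' u) ?eqxx// uE -h.
rewrite big1// => u _; rewrite indicE memNset ?mulr0//= => h.
by apply: nu; exists u.
Qed.

Lemma discrete_law_sum_le1 m : \sum_(u : K m) law (e u) <= 1.
Proof.
(* The sum of the masses is the expectation of the indicator of the box, written as a truncation of
   the constant 1 so that [truncE] applies. *)
pose g w : R[i] :=
  \sum_(u : K m) (fun=> 1) (e u) * (\1_[set w' | U w' = e u] w)%:C.
have -> : \sum_(u : K m) law (e u) = complex.Re (expectationC P g).
  rewrite expectationC_sum => [|u]; last exact: (int_indC _ _).1.
  rewrite (big_morph _ complex_ReD (erefl _)).
  by apply: eq_bigr => u _; rewrite (int_indC _ _).2 mul1r.
rewrite -[leRHS](_ : \int[P]_w cst 1 w = 1); last first.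
  by rewrite Rintegral_cst// mul1r [X in fine X]probability_setT.
apply: le_Rintegral => //.
- by apply: (cintegrable_sum _ _).1 => u; exact: (int_indC _ _).1.
- exact: finite_measure_integrable_cst.
- move=> w _ /=; rewrite [g w](truncE m (fun=> 1)).
  by case: pselect => _ /=.
Qed.

(** Each value of [U] lies in all late boxes, so the truncations of [f \o U] are eventually exact at
    each sample point, and they stay bounded by 1. *)
Lemma cvgC_discrete_expectation (f : Omega -> R[i]) :
  (forall x, `|f x| <= 1) ->
  cvgC (fun m => \sum_(u : K m) f (e u) * (law (e u))%:C)
       (expectationC P (f \o U)).
Proof.
move=> f1.
have -> : (fun m => \sum_(u : K m) f (e u) * (law (e u))%:C) =
    (fun m => expectationC P
      (fun w => \sum_(u : K m) f (e u) * (\1_[set w' | U w' = e u] w)%:C)).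
  apply/funext => m; rewrite expectationC_sum => [|u]; last exact: (int_indC _ _).1.
  by apply: eq_bigr => u _; rewrite (int_indC _ _).2.
apply: (ae_bounded_cvg_expectationC (M := 1)).
- move=> m; apply: cmeasurable_sum => u.
  apply: cmeasurableM; first exact: cmeasurable_cst.
  exact: cmeasurable_real.
- move=> w; apply: (cvgC_near _ (cvgC_cst _)).
  move: (e_exhaust (U w)); apply: filterS => m ex.
  by rewrite truncE; case: pselect.
- apply: aeW => w m; rewrite truncE; case: pselect => h; first exact: f1.
  by rewrite normr0 ler01.
Qed.

End discrete_expectation.

Lemma norm_prod_le1 (K : numDomainType) (I : Type) (r : seq I) (p : pred I)
    (F : I -> K) :
  (forall j, `|F j| <= 1) -> `|\prod_(j <- r | p j) F j| <= 1.
Proof.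
move=> F1; elim/big_ind: _ => [|x y x1 y1|j _]; rewrite ?normr1 ?normrM//.
exact: mulr_ile1.
Qed.

(** * The joint law of the variables of one step *)

Section state_law.
Context {R : realType} d (T : measurableType d) (P : probability T R) (N : nat)
  (S : polling_system R N) (Q : polling_process P S) (n : nat).
Let i := queue Q n.

(* The means of the numbers of customers that arrive during a visit of length
   [v] to queue [i] and are still present at its end. *)
Definition visit_mean (v : R) (j : 'I_N) : R :=
  if j == i then Lambda S i v else arrival_rate S j * v.

(** Conditional mass, for a visit of length [v] that finds [x] customers in the visited queue, of
    the increments [c] and of [k] unserved old customers. *)
Definition visit_kernel (x : nat) (c : 'I_N -> nat) (k : nat) (v : R) : R :=
  (\prod_j poisson_mass (visit_mean v j) (c j)) *
  binomial_pmf x (1 - service_cdf S i v) k.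

Definition switch_kernel (b : 'I_N -> nat) (u : R) : R :=
  \prod_j poisson_mass (arrival_rate S j * u) (b j).

(** Storing [left_new] at coordinate [i] gathers all Poisson counts of the visit in one vector over
    ['I_N]. *)
Definition visit_increment (w : T) (j : 'I_N) : nat :=
  if j == i then left_new Q n w else arr_visit Q n j w.

(** The discrete data that determine the next queue lengths; the box sums run over its values. *)
Definition step_state (w : T) :=
  ((qlen Q n ^~ w, visit_increment w), (arr_switch Q n ^~ w, left_old Q n w)).

Definition qlen_law (x : 'I_N -> nat) : R :=
  fine (P [set w | qlen Q n ^~ w = x]).

Lemma visit_mean_ge0 v j : 0 <= v -> 0 <= visit_mean v j.
Proof.
move=> v0; rewrite /visit_mean; case: ifP => _; first exact: Lambda_ge0.
by rewrite mulr_ge0// ltW// arrival_rate_gt0.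
Qed.

Lemma measurable_visit_mean j : measurable_fun [set: R] (visit_mean ^~ j).
Proof.
rewrite /visit_mean; case: eqP => _; first exact: measurable_Lambda.
exact: measurable_funM.
Qed.

Let cdfC_itv01 v : 0 <= 1 - service_cdf S i v <= 1.
Proof. by have := service_cdf_itv01 S i v; lra. Qed.

Lemma visit_kernel_ge0 x c k v : 0 <= v -> 0 <= visit_kernel x c k v.
Proof.
move=> v0; rewrite mulr_ge0 ?binomial_pmf_ge0//.
by rewrite prodr_ge0// => j _; rewrite poisson_mass_ge0 ?visit_mean_ge0.
Qed.

Lemma switch_kernel_ge0 b u : 0 <= u -> 0 <= switch_kernel b u.
Proof.
move=> u0; apply: prodr_ge0 => j _; rewrite poisson_mass_ge0// mulr_ge0//.
by rewrite ltW// arrival_rate_gt0.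
Qed.

Lemma visit_time_ae_ge0 : {ae visit_law S i, forall v : R, 0 <= v}.
Proof.
exists `]-oo, 0[%classic; split => //; first exact: visit_law_ge0.
by move=> v /= /negP; rewrite -ltNge in_itv.
Qed.

Lemma switch_time_ae_ge0 : {ae switch_law S i, forall v : R, 0 <= v}.
Proof.
exists `]-oo, 0[%classic; split => //; first exact: switch_law_ge0.
by move=> v /= /negP; rewrite -ltNge in_itv.
Qed.

Let visit_ae_ge0 : {ae P, forall w, 0 <= visit Q n w}.
Proof.
exists (visit Q n @^-1` `]-oo, 0[%classic); split.
- exact: measurable_funPTI.
- rewrite -[LHS]/(distribution P (visit Q n) _) visit_time_law//.
  exact: visit_law_ge0.
- by move=> v /= /negP; rewrite -ltNge in_itv.
Qed.

Let switch_ae_ge0 : {ae P, forall w, 0 <= switch Q n w}.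
Proof.
exists (switch Q n @^-1` `]-oo, 0[%classic); split.
- exact: measurable_funPTI.
- rewrite -[LHS]/(distribution P (switch Q n) _) switch_time_law//.
  exact: switch_law_ge0.
- by move=> v /= /negP; rewrite -ltNge in_itv.
Qed.

(** At nonnegative times the Poisson factors are at most 1 and the binomial one at most ['C(x, k)];
    this holds almost surely for the visit law. *)
Lemma integrable_visit_kernel x c k :
  (visit_law S i).-integrable [set: R] (EFin \o visit_kernel x c k).
Proof.
apply: (ae_bounded_integrable (M := 'C(x, k)%:R)).
  apply: measurable_funM.
    apply: measurable_prod => j _.
    apply: (measurableT_comp (measurable_poisson_mass (c j))).
    exact: measurable_visit_mean.
  apply: (measurableT_comp (measurable_binomial_pmf x k)).
  by apply: measurable_funB => //; exact: measurable_service_cdf.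
move: visit_time_ae_ge0; apply: filterS => v v0; rewrite normrM.
have /andP[b0 b1] := binomial_pmf_le x k (cdfC_itv01 v).
rewrite (ger0_norm b0) -[leRHS]mul1r ler_pM//.
apply: norm_prod_le1 => j.
by rewrite ger0_norm ?poisson_mass_ge0 ?poisson_mass_le1// visit_mean_ge0.
Qed.

Lemma integrable_switch_kernel b :
  (switch_law S i).-integrable [set: R] (EFin \o switch_kernel b).
Proof.
apply: (ae_bounded_integrable (M := 1)).
  apply: measurable_prod => j _.
  apply: (measurableT_comp (measurable_poisson_mass (b j))).
  exact: measurable_funM.
move: switch_time_ae_ge0; apply: filterS => u u0; apply: norm_prod_le1 => j.
have h : 0 <= arrival_rate S j * u.
  by rewrite mulr_ge0// ltW// arrival_rate_gt0.
by rewrite ger0_norm ?poisson_mass_ge0 ?poisson_mass_le1.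
Qed.

Let measurable_forall_eq (Y : 'I_N -> {RV P >-> nat}) (p : pred 'I_N)
  (a : 'I_N -> nat) : measurable [set w | forall j, p j -> Y j w = a j].
Proof.
rewrite (_ : [set _ | _] = \bigcap_(j in [set j | p j]) (Y j @^-1` [set a j])).
  apply: fin_bigcap_measurable => [|j _]; first exact: finite_finset.
  exact: measurable_funPTI.
by apply/seteqP; split.
Qed.

Lemma measurable_qlen_eq x : measurable [set w | qlen Q n ^~ w = x].
Proof.
rewrite (_ : [set _ | _] = [set w | forall j, predT j -> qlen Q n j w = x j]).
  exact: measurable_forall_eq.
apply/seteqP; split => w /=; first by move=> <-.
by move=> h; apply/funext => j; exact: h.
Qed.

Let step_stateE x c b k : [set w | step_state w = ((x, c), (b, k))] =
  [set w | [/\ forall j, qlen Q n j w = x j,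
              setT (visit Q n w) & setT (switch Q n w)]] `&`
  [set w | [/\ forall j, j != i -> arr_visit Q n j w = c j,
              left_old Q n w = k, left_new Q n w = c i
            & forall j, arr_switch Q n j w = b j]].
Proof.
apply/seteqP; split => [w [<- <- <- <-]|w /=].
  split => //; split => //; first by move=> j /negbTE ji; rewrite /visit_increment ji.
  by rewrite /visit_increment eqxx.
move=> [[hx _ _] [hc hk hl hb]]; rewrite /step_state hk.
have -> : qlen Q n ^~ w = x by apply/funext.
have -> : arr_switch Q n ^~ w = b by apply/funext.
suff -> : visit_increment w = c by [].
apply/funext => j; rewrite /visit_increment.
by case: eqP => [->//|/eqP]; exact: hc.
Qed.

Let qlen_set x : [set w | [/\ forall j, qlen Q n j w = x j,
    setT (visit Q n w) & setT (switch Q n w)]] = [set w | qlen Q n ^~ w = x].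
Proof.
apply/seteqP; split => w /=; first by move=> [h _ _]; apply/funext.
by move=> <-; split.
Qed.

Lemma measurable_step_state_eq s : measurable [set w | step_state w = s].
Proof.
case: s => [[x c] [b k]]; rewrite step_stateE qlen_set.
apply: measurableI; first exact: measurable_qlen_eq.
rewrite (_ : [set _ | _] =
  [set w | forall j, j != i -> arr_visit Q n j w = c j] `&`
  (left_old Q n @^-1` [set k] `&` left_new Q n @^-1` [set c i]) `&`
  [set w | forall j, predT j -> arr_switch Q n j w = b j]).
  apply: measurableI; last exact: measurable_forall_eq.
  apply: measurableI; first exact: measurable_forall_eq.
  by apply: measurableI; exact: measurable_funPTI.
apply/seteqP; split => w /=; first by move=> [].
by move=> [[? [? ?]] h]; split => // j; exact: h.
Qed.

(** The conditional law with [E] and [F] the whole line gives an integral over the event that the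
    queue lengths are [x]. Its integrand splits into a function of the visit time and one of the
    switch-over time, so independence factors it. *)
Lemma step_state_law x c b k :
  fine (P [set w | step_state w = ((x, c), (b, k))]) =
  qlen_law x * (\int[visit_law S i]_v visit_kernel (x i) c k v *
                \int[switch_law S i]_u switch_kernel b u).
Proof.
rewrite step_stateE conditional_law//=; rewrite -/i qlen_set.
rewrite -(Rintegral_independent_nneg (measurable_qlen_eq x)
   (V := visit Q n) (W := switch Q n))//.
- congr fine; apply: eq_integral => w; rewrite inE /= => xE.
  congr EFin; rewrite /visit_kernel /switch_kernel -xE.
  (* In [visit_kernel] the factor at [i] is the mass of [left_new]; the others belong to
     [arr_visit]. *)
  rewrite [in RHS](bigD1 i)//= {1}/visit_mean eqxx.
  rewrite [in RHS](eq_bigr (fun j =>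
    poisson_mass (arrival_rate S j * visit Q n w) (c j))); last first.
    by move=> j /negbTE ji; rewrite /visit_mean ji.
  set A := \prod_(j | _) _; set B := \prod_j _.
  by congr (_ * _); rewrite mulrC mulrA.
- move=> E F mE mF.
  have := qlen_visit_switch_independent Q n x mE mF.
  rewrite -visit_time_law// -switch_time_law//.
  have -> : [set w | forall j, qlen Q n j w = x j] = [set w | qlen Q n ^~ w = x].
    apply/seteqP; split => w /=; first by move=> h; apply/funext.
    by move=> <-.
  move=> <-; congr (P _); apply/seteqP; split => w /=.
    by move=> [<- [? ?]].
  by move=> [h ? ?]; split => //; apply/funext.
- exact: visit_time_ae_ge0.
- exact: switch_time_ae_ge0.
- exact: integrable_visit_kernel.
- exact: integrable_switch_kernel.
- by move=> v v0; exact: visit_kernel_ge0.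
- by move=> v v0; exact: switch_kernel_ge0.
Qed.

End state_law.

(** Every side length [m] above the largest coordinate of [x] works. *)
Lemma ffun_ord_exhaust (N : nat) (x : 'I_N -> nat) :
  \forall m \near \oo, exists u : {ffun 'I_N -> 'I_m}, (fun j => u j : nat) = x.
Proof.
exists (\max_j x j).+1 => // m /= xm.
have h j : (x j < m)%N by apply: leq_trans xm; rewrite ltnS leq_bigmax.
by exists [ffun j => Ordinal (h j)]; apply/funext => j; rewrite ffunE.
Qed.

Lemma ffun_ord_inj (N m : nat) :
  injective (fun (u : {ffun 'I_N -> 'I_m}) j => u j : nat).
Proof.
move=> u v uv; apply/ffunP => j; apply: val_inj.
exact: (congr1 (fun f => f j) uv).
Qed.

(** * The generating function after one step *)

Section generating_functions.
Context {R : realType} d (T : measurableType d) (P : probability T R) (N : nat)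
  (S : polling_system R N) (Q : polling_process P S) (n : nat).
Let i := queue Q n.

Lemma cvgC_pgf_qlen (y : 'I_N -> R[i]) : (forall j, `|y j| <= 1) ->
  cvgC (fun m => \sum_(x : {ffun 'I_N -> 'I_m})
          (\prod_j y j ^+ x j) * (qlen_law Q n (fun j => x j))%:C)
       (pgf P (qlen Q n) y).
Proof.
move=> y1.
apply: (@cvgC_discrete_expectation _ _ _ P ('I_N -> nat) (fun w => qlen Q n ^~ w)
  (fun m => {ffun 'I_N -> 'I_m}) (fun m u j => u j : nat) _ _ _
  (fun x => \prod_j y j ^+ x j)).
- by move=> m; exact: ffun_ord_inj.
- exact: ffun_ord_exhaust.
- exact: measurable_qlen_eq.
- by move=> x; apply: norm_prod_le1 => j; rewrite normrX exprn_ile1.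
Qed.

Lemma qlen_law_sum_le1 m :
  \sum_(x : {ffun 'I_N -> 'I_m}) qlen_law Q n (fun j => x j) <= 1.
Proof.
apply: (@discrete_law_sum_le1 _ _ _ P ('I_N -> nat) (fun w => qlen Q n ^~ w)
  (fun m => {ffun 'I_N -> 'I_m}) (fun m u j => u j : nat)).
- by move=> k; exact: ffun_ord_inj.
- exact: measurable_qlen_eq.
Qed.

Variable z : 'I_N -> R[i].
Hypothesis z1 : forall j, `|z j| <= 1.

(** At [i] this is the generating function of the indicator that one old customer is unserved after
    time [v]. *)
Definition thinned (v : R) (j : 'I_N) : R[i] :=
  if j == i then (service_cdf S i v)%:C + (1 - (service_cdf S i v)%:C) * z i
  else z j.

Lemma norm_thinned_le1 v j : `|thinned v j| <= 1.
Proof.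
rewrite /thinned; case: ifP => // _.
(* At [i] the value is a convex combination of 1 and [z i]. *)
have /andP[p0 p1] := service_cdf_itv01 S i v.
have -> : 1 - (service_cdf S i v)%:C = (1 - service_cdf S i v)%:C :> R[i].
  by rewrite rmorphB rmorph1.
apply: (le_trans (ler_normD _ _)); rewrite normrM !normC_real.
have q0 : 0 <= 1 - service_cdf S i v by rewrite subr_ge0.
rewrite (ger0_norm p0) (ger0_norm q0).
apply: (@le_trans _ _ ((service_cdf S i v)%:C + (1 - service_cdf S i v)%:C)).
  by rewrite lerD2l ler_piMr// ler0c.
by rewrite -rmorphD /= addrC subrK.
Qed.

Let monomial (x c b : 'I_N -> nat) (k : nat) : R[i] :=
  \prod_j z j ^+ ((if j == i then k else x j) + c j + b j).

(** The integrand of the visit expectation with the Poisson counts and the queue lengths cut off at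
    [m]. *)
Let visit_trunc m (v : R) : R[i] :=
  (\prod_j \sum_(c < m) z j ^+ c * (poisson_mass (visit_mean Q n v j) c)%:C) *
  \sum_(x : {ffun 'I_N -> 'I_m})
    (\prod_j thinned v j ^+ x j) * (qlen_law Q n (fun j => x j))%:C.

Let switch_trunc m (u : R) : R[i] :=
  \prod_j \sum_(b < m) z j ^+ b * (poisson_mass (arrival_rate S j * u) b)%:C.

Let visit_truncE m v : visit_trunc m v =
  \sum_(x : {ffun 'I_N -> 'I_m}) \sum_(c : {ffun 'I_N -> 'I_m}) \sum_(k < m)
    (monomial (fun j => x j) (fun j => c j) (fun=> 0%N) k *
       (qlen_law Q n (fun j => x j))%:C) *
    (visit_kernel Q n (x i) (fun j => c j) k v)%:C.
Proof.
rewrite /visit_trunc mulr_sumr; apply: eq_bigr => x _.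
rewrite bigA_distr_bigA /= mulr_suml; apply: eq_bigr => c _.
have -> : \prod_j thinned v j ^+ x j =
    \sum_(k < m) (\prod_j z j ^+ (if j == i then k : nat else x j)) *
      (binomial_pmf (x i) (1 - service_cdf S i v) k)%:C.
  (* The factor at [i] is a binomial transform, exact in the box because [x i < m]; the service
     probability is first rewritten as [1 - (1 - p)] to fit it. *)
  rewrite (bigD1 i)//= {1}/thinned eqxx.
  have -> : (service_cdf S i v)%:C + (1 - (service_cdf S i v)%:C) * z i =
     (1 - (1 - service_cdf S i v))%:C + (1 - service_cdf S i v)%:C * z i.
    by rewrite subKr rmorphB rmorph1.
  rewrite -(binomial_transform _ _ (ltn_ord (x i))) mulr_suml; apply: eq_bigr => k _.
  rewrite mulrAC; congr (_ * _); rewrite [RHS](bigD1 i)//= eqxx; congr (_ * _).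
  by apply: eq_bigr => j /negbTE ji; rewrite /thinned ji.
rewrite mulr_suml mulr_sumr; apply: eq_bigr => k _.
rewrite /visit_kernel rmorphM rmorph_prod big_split /=.
have -> : monomial (fun j => x j) (fun j => c j) (fun=> 0%N) k =
    (\prod_j z j ^+ (if j == i then k : nat else x j)) * \prod_j z j ^+ c j.
  rewrite /monomial -big_split; apply: eq_bigr => j _ /=.
  by rewrite addn0 exprD.
set a1 := \prod_j z j ^+ c j; set a2 := \prod_j (poisson_mass _ _)%:C.
set a3 := \prod_j _; set a4 := (binomial_pmf _ _ _)%:C; set a5 := (qlen_law _ _ _)%:C.
by move: a1 a2 a3 a4 a5 => a1 a2 a3 a4 a5; ring.
Qed.

Let switch_truncE m u : switch_trunc m u =
  \sum_(b : {ffun 'I_N -> 'I_m})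
    (\prod_j z j ^+ b j) * (switch_kernel S (fun j => b j) u)%:C.
Proof.
rewrite /switch_trunc bigA_distr_bigA; apply: eq_bigr => b _ /=.
by rewrite big_split /switch_kernel rmorph_prod.
Qed.

(** All sums are finite, so linearity turns both expectations into sums of integrals of kernels, and
    [step_state_law] recognises the products as joint masses. *)
Let law_trunc m :
  expectationC (visit_law S i) (visit_trunc m) *
    expectationC (switch_law S i) (switch_trunc m) =
  \sum_(s : ({ffun 'I_N -> 'I_m} * {ffun 'I_N -> 'I_m}) *
            ({ffun 'I_N -> 'I_m} * 'I_m))
    monomial (fun j => s.1.1 j) (fun j => s.1.2 j) (fun j => s.2.1 j) s.2.2 *
    (fine (P [set w | step_state Q n w = ((fun j => s.1.1 j : nat,
       fun j => s.1.2 j : nat), (fun j => s.2.1 j : nat, s.2.2 : nat))]))%:C.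
Proof.
pose F (x c : {ffun 'I_N -> 'I_m}) (k : 'I_m) : R[i] :=
  (monomial (fun j => x j) (fun j => c j) (fun=> 0%N) k *
     (qlen_law Q n (fun j => x j))%:C) *
  (\int[visit_law S i]_v visit_kernel Q n (x i) (fun j => c j) k v)%:C.
pose H (b : {ffun 'I_N -> 'I_m}) : R[i] := (\prod_j z j ^+ b j) *
  (\int[switch_law S i]_u switch_kernel S (fun j => b j) u)%:C.
have -> : expectationC (visit_law S i) (visit_trunc m) =
    \sum_x \sum_c \sum_k F x c k.
  rewrite (funext (visit_truncE m)).
  have int x c k := cintegrableZ_real
    (monomial (fun j => x j) (fun j => c j) (fun=> 0%N) k *
     (qlen_law Q n (fun j => x j))%:C)
    (integrable_visit_kernel Q n (x i) c k).
  rewrite expectationC_sum => [|x]; last first.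
    by apply: cintegrable_sum => c; apply: cintegrable_sum => k; exact: int.
  apply: eq_bigr => x _; rewrite expectationC_sum => [|c]; last first.
    by apply: cintegrable_sum => k; exact: int.
  apply: eq_bigr => c _; rewrite expectationC_sum => [|k]; last exact: int.
  apply: eq_bigr => k _; apply: expectationCZ_real.
  exact: integrable_visit_kernel.
have -> : expectationC (switch_law S i) (switch_trunc m) = \sum_b H b.
  rewrite (funext (switch_truncE m)).
  rewrite expectationC_sum => [|b]; last first.
    by apply: cintegrableZ_real; exact: integrable_switch_kernel.
  apply: eq_bigr => b _; apply: expectationCZ_real.
  exact: integrable_switch_kernel.
transitivity (\sum_s F s.1.1 s.1.2 s.2.2 * H s.2.1); last first.
  apply: eq_bigr => -[[x c] [b k]] _ /=; rewrite step_state_law !rmorphM /=.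
  have -> : monomial (fun j => x j) (fun j => c j) (fun j => b j) k =
      monomial (fun j => x j) (fun j => c j) (fun=> 0%N) k *
      \prod_j z j ^+ b j.
    rewrite /monomial -big_split; apply: eq_bigr => j _ /=.
    by rewrite addn0 exprD.
  rewrite /F /H; move: (monomial _ _ _ _) (\prod_j _) (qlen_law _ _ _)%:C.
  move: (\int[_]_v _)%:C (\int[_]_v _)%:C => a1 a2 a3 a4 a5.
  by ring.
(* The sum over quadruples becomes an iterated sum, out of which the visit and switch-over parts
   separate. *)
rewrite -(pair_bigA _ (fun p r => F p.1 p.2 r.2 * H r.1)) /=.
rewrite -(pair_bigA _ (fun x c => \sum_r F x c r.2 * H r.1)) /=.
rewrite mulr_suml; apply: eq_bigr => x _.
rewrite mulr_suml; apply: eq_bigr => c _.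
rewrite -(pair_bigA _ (fun b k => F x c k * H b)) /=.
by rewrite mulr_sumr; apply: eq_bigr => b _; rewrite mulr_suml.
Qed.

Let state_pgfE : pgf P (qlen Q n.+1) z = expectationC P
  ((fun s => monomial s.1.1 s.1.2 s.2.1 s.2.2) \o step_state Q n).
Proof.
congr expectationC; apply/funext => w; apply: eq_bigr => j _ /=.
rewrite law_of_motion -/i /visit_increment -/i.
by case: eqP.
Qed.

Let ordered_state m (s : ({ffun 'I_N -> 'I_m} * {ffun 'I_N -> 'I_m}) *
    ({ffun 'I_N -> 'I_m} * 'I_m)) :=
  ((fun j => s.1.1 j : nat, fun j => s.1.2 j : nat),
   (fun j => s.2.1 j : nat, s.2.2 : nat)).

(** By [law_trunc] the sequence consists of box sums of the monomial in the step state, whose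
    expectation is the new generating function. *)
Let cvgC_state_pgf : cvgC
  (fun m => expectationC (visit_law S i) (visit_trunc m) *
            expectationC (switch_law S i) (switch_trunc m))
  (pgf P (qlen Q n.+1) z).
Proof.
rewrite state_pgfE; under eq_fun do rewrite law_trunc.
apply: (@cvgC_discrete_expectation _ _ _ P _ (step_state Q n) _ ordered_state
  _ _ _ (fun s => monomial s.1.1 s.1.2 s.2.1 s.2.2)).
- move=> m [[x c] [b k]] [[x' c'] [b' k']] [].
  by move=> /ffun_ord_inj -> /ffun_ord_inj -> /ffun_ord_inj -> /val_inj ->.
(* A side length large enough for all four components at once. *)
- move=> [[x c] [b k]]; near=> m.
  have [x' xE] : exists x' : {ffun 'I_N -> 'I_m}, (fun j => x' j : nat) = x.
    by near: m; exact: ffun_ord_exhaust.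
  have [c' cE] : exists c' : {ffun 'I_N -> 'I_m}, (fun j => c' j : nat) = c.
    by near: m; exact: ffun_ord_exhaust.
  have [b' bE] : exists b' : {ffun 'I_N -> 'I_m}, (fun j => b' j : nat) = b.
    by near: m; exact: ffun_ord_exhaust.
  have km : (k < m)%N by near: m; exists k.+1.
  by exists ((x', c'), (b', Ordinal km)); rewrite /ordered_state /= xE cE bE.
- exact: measurable_step_state_eq.
- by move=> s; apply: norm_prod_le1 => j; rewrite normrX exprn_ile1.
Unshelve. all: by end_near. Qed.

Let cvgC_visit_trunc : cvgC
  (fun m => expectationC (visit_law S i) (visit_trunc m))
  (expectationC (visit_law S i) (fun v =>
     (\prod_j expC (- ((visit_mean Q n v j)%:C * (1 - z j)))) *
     pgf P (qlen Q n) (thinned v))).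
Proof.
apply: (ae_bounded_cvg_expectationC (M := 1)).
- move=> m; apply: cmeasurableM.
    apply: cmeasurable_prod => j; apply: cmeasurable_sum => c.
    apply: cmeasurableM; first exact: cmeasurable_cst.
    apply: cmeasurable_real.
    apply: (measurableT_comp (measurable_poisson_mass c)).
    exact: measurable_visit_mean.
  apply: cmeasurable_sum => x; apply: cmeasurableM; last exact: cmeasurable_cst.
  apply: cmeasurable_prod => j; apply: cmeasurableX; rewrite /thinned.
  case: (j == i); last exact: cmeasurable_cst.
  have mp := cmeasurable_real (measurable_service_cdf S i).
  apply: cmeasurableD => //; apply: cmeasurableM; last exact: cmeasurable_cst.
  apply: cmeasurableD; first exact: cmeasurable_cst.
  under eq_fun do rewrite -mulN1r.
  by apply: cmeasurableM => //; exact: cmeasurable_cst.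
- move=> v; apply: cvgCM; first by apply: cvgC_prod => j; exact: cvgC_poisson_transform.
  by apply: cvgC_pgf_qlen => j; exact: norm_thinned_le1.
(* The bound 1 combines truncated Poisson transforms of modulus at most 1 with the total mass, at
   most 1, of the queue-length law on the box. *)
- move: (visit_time_ae_ge0 Q n); apply: filterS => v v0 m.
  rewrite normrM mulr_ile1//.
    apply: norm_prod_le1 => j.
    by apply: norm_poisson_transform_le1 => //; exact: visit_mean_ge0.
  apply: (le_trans (ler_norm_sum _ _ _)).
  apply: (@le_trans _ _ (\sum_(x : {ffun 'I_N -> 'I_m})
    (qlen_law Q n (fun j => x j))%:C)); last first.
    by rewrite -rmorph_sum lecR qlen_law_sum_le1.
  apply: ler_sum => x _; rewrite normrM normC_real.
  have l0 : 0 <= qlen_law Q n (fun j => x j) by rewrite fine_ge0.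
  rewrite (ger0_norm l0) ler_piMl ?ler0c//.
  by apply: norm_prod_le1 => j; rewrite normrX exprn_ile1// norm_thinned_le1.
Qed.

Let cvgC_switch_trunc : cvgC
  (fun m => expectationC (switch_law S i) (switch_trunc m))
  (switch_LST S i (\sum_j (arrival_rate S j)%:C * (1 - z j))).
Proof.
(* The exponential of the sum over queues splits into one Poisson transform per queue. *)
have -> : switch_LST S i (\sum_j (arrival_rate S j)%:C * (1 - z j)) =
    expectationC (switch_law S i) (fun u =>
      \prod_j expC (- ((arrival_rate S j * u)%:C * (1 - z j)))).
  congr expectationC; apply/funext => u; rewrite -expC_sum; congr expC.
  rewrite mulr_suml -sumrN; apply: eq_bigr => j _.
  by rewrite rmorphM mulrAC.
apply: (ae_bounded_cvg_expectationC (M := 1)).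
- move=> m; apply: cmeasurable_prod => j; apply: cmeasurable_sum => b.
  apply: cmeasurableM; first exact: cmeasurable_cst.
  apply: cmeasurable_real.
  apply: (measurableT_comp (measurable_poisson_mass b)).
  exact: measurable_funM.
- by move=> u; apply: cvgC_prod => j; exact: cvgC_poisson_transform.
- move: (switch_time_ae_ge0 Q n); apply: filterS => u u0 m.
  apply: norm_prod_le1 => j; apply: norm_poisson_transform_le1 => //.
  by rewrite mulr_ge0// ltW// arrival_rate_gt0.
Qed.

(** Both sides are limits of the same sequence of products of truncated expectations. *)
Lemma pgf_step : pgf P (qlen Q n.+1) z =
  switch_LST S i (\sum_j (arrival_rate S j)%:C * (1 - z j)) *
  expectationC (visit_law S i) (fun v =>
    (\prod_j expC (- ((visit_mean Q n v j)%:C * (1 - z j)))) *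
    pgf P (qlen Q n) (thinned v)).
Proof.
rewrite mulrC; apply: cvgC_unique cvgC_state_pgf _.
exact: cvgCM cvgC_visit_trunc cvgC_switch_trunc.
Qed.

End generating_functions.

Local Close Scope classical_set_scope.

Theorem mainTheorem3 (d : measure_display) (T : measurableType d)
    (R : realType) (P : probability T R) (N : nat) (hN : (2 <= N)%N)
    (S : polling_system R N) (Q : polling_process P S)
    (n : nat) (i : 'I_N) (hi : queue Q n = i)
    (z : 'I_N -> R[i]) (hz : forall j, `|z j| <= 1) :
  pgf P (qlen Q n.+1) z =
    switch_LST S i (\sum_j (arrival_rate S j)%:C * (1 - z j)) *
    expectationC (visit_law S i) (fun v : R =>
      expC (- (v%:C * \sum_(j | j != i) (arrival_rate S j)%:C * (1 - z j))) *
      expC (- ((Lambda S i v)%:C * (1 - z i))) *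
      pgf P (qlen Q n)
        (fun j => if j == i
                  then (service_cdf S i v)%:C + (1 - (service_cdf S i v)%:C) * z i
                  else z j)).
Proof.
rewrite (pgf_step Q n hz); subst i; set i := queue Q n.
have -> : (fun v : R =>
    (\prod_j expC (- ((visit_mean Q n v j)%:C * (1 - z j)))) *
    pgf P (qlen Q n) (thinned Q n z v)) = (fun v : R =>
    expC (- (v%:C * \sum_(j | j != i) (arrival_rate S j)%:C * (1 - z j))) *
    expC (- ((Lambda S i v)%:C * (1 - z i))) *
    pgf P (qlen Q n) (thinned Q n z v)).
  apply/funext => v; congr (_ * _).
  (* The factor at [i] is the one with mean [Lambda]; the remaining factors merge into a single
     exponential with [v] taken out. *)
  rewrite (bigD1 i)//= {1}/visit_mean eqxx mulrC; congr (_ * _).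
  rewrite -expC_sum mulr_sumr -sumrN; congr expC.
  apply: eq_bigr => j /negbTE ji; rewrite /visit_mean ji.
  by rewrite rmorphM mulrA [(arrival_rate S j)%:C * _]mulrC.
by [].
Qed.
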